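(* Let $\alpha$ be a positive real number for which there exist a constant $C>0$ and a constant $d\geq 2$ such that $$\frac{C}{q^d}\leq |p-\alpha q|$$ for all relatively prime integers $p$ and $q$ with $q\geq 1$. Then for every $k>1$ and every $\beta>2$, $$\lim_{N\to\infty}\frac{\log Z_N(\alpha;\beta)}{N^k}=0;$$ in particular $\alpha$ has a $k$-free energy limit for $\beta>2$, equal to zero.
   Context: Let $A_0=\begin{pmatrix}1&0\\1&1\end{pmatrix}$ and $A_1=\begin{pmatrix}1&1\\0&1\end{pmatrix}$. For a real number $\alpha$, a real number $\beta$ and a positive integer $N$, the Diophantine partition function is $$Z_N(\alpha;\beta)=\sum_{(i_1,\ldots,i_N)\in\{0,1\}^N}\frac{1}{|\alpha q-p|^{\beta}},$$ where $\binom{p}{q}$ denotes the right (second) column of the product $A_{i_1}A_{i_2}\cdots A_{i_N}$. A real $\alpha$ has a $k$-free energy limit if there is $\beta_c$ such that $\lim_{N\to\infty}\log(Z_N(\alpha;\beta))/N^k$ exists for all $\beta>\beta_c$. *)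

(* Defs.v *)
From mathcomp Require Import all_boot all_order all_algebra.
From mathcomp Require Import all_classical all_reals all_analysis.

Set Implicit Arguments.
Unset Strict Implicit.
Unset Printing Implicit Defensive.

Import Order.TTheory GRing.Theory Num.Theory.
Import numFieldNormedType.Exports.

Local Open Scope classical_set_scope.
Local Open Scope ring_scope.

Definition mx22 (a b c d : int) : 'M[int]_2 :=
  \matrix_(i < 2, j < 2) (nth [::] [:: [:: a; b]; [:: c; d]] i)`_j.

(* The index set {0, 1} is rendered by bool: A_0 = A false, A_1 = A true. *)
Definition A (b : bool) : 'M[int]_2 :=
  if b then mx22 1 1 0 1 else mx22 1 0 1 1.

Definition mxword (N : nat) (i : {ffun 'I_N -> bool}) : 'M[int]_2 :=
  \prod_(j < N) A (i j).

Definition wordp (N : nat) (i : {ffun 'I_N -> bool}) : int :=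
  mxword i ord0 ord_max.

Definition wordq (N : nat) (i : {ffun 'I_N -> bool}) : int :=
  mxword i ord_max ord_max.

Definition Z (R : realType) (N : nat) (alpha beta : R) : R :=
  \sum_(i : {ffun 'I_N -> bool})
    1 / (`|alpha * (wordq i)%:~R - (wordp i)%:~R| `^ beta).

Definition free_energy_seq (R : realType) (k alpha beta : R) : nat -> R :=
  fun N => ln (Z N alpha beta) / (N%:R `^ k).

(* The limit is required to be a (finite) real number: cvg is taken in R. *)
Definition free_energy_limit_above (R : realType) (k alpha beta_c : R) : Prop :=
  forall beta : R, beta_c < beta ->
    cvg (free_energy_seq k alpha beta @ \oo).

Definition has_free_energy_limit (R : realType) (k alpha : R) : Prop :=
  exists beta_c : R, free_energy_limit_above k alpha beta_c.

(* Main.v *)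
Require Import Defs.
From mathcomp Require Import all_boot all_order all_algebra.
From mathcomp Require Import all_classical all_reals all_analysis.
From mathcomp Require Import ring lra.

Import Order.TTheory GRing.Theory Num.Theory.
Import numFieldNormedType.Exports.

Local Open Scope classical_set_scope.
Local Open Scope ring_scope.

(* Both entries p, q of the right column of a word of length N are coprime and
   at most 2^N. The upper bound on p and q bounds every |alpha q - p| above by
   an exponential in N, and the Diophantine hypothesis bounds it below by one.
   As Z_N has 2^N terms, log Z_N is O(N), which N^k dominates for k > 1. *)

Lemma A_mul_col_top (b : bool) (M : 'M[int]_2) (j : 'I_2) :
  (A b *m M) ord0 j = M ord0 j + b%:R * M ord_max j.
Proof.
rewrite mxE big_ord_recl big_ord1.
have -> : lift ord0 ord0 = ord_max :> 'I_2 by apply: val_inj.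
by case: b; rewrite /A /mx22 !mxE /= ?mul1r ?mul0r.
Qed.

Lemma A_mul_col_bottom (b : bool) (M : 'M[int]_2) (j : 'I_2) :
  (A b *m M) ord_max j = (~~ b)%:R * M ord0 j + M ord_max j.
Proof.
rewrite mxE big_ord_recl big_ord1.
have -> : lift ord0 ord0 = ord_max :> 'I_2 by apply: val_inj.
by case: b; rewrite /A /mx22 !mxE /= ?mul1r ?mul0r.
Qed.

(** Induction on the first letter: left multiplication by [A b] adds one entry of the column to the
    other. This preserves the gcd, and since both entries are nonnegative it at most doubles
    [p + q]. Bounding the sum rather than each entry makes the induction close; the empty word gives
    the column (0, 1). *)
Lemma prodA_right_column (N : nat) (f : 'I_N -> bool) :
  let M := \prod_(j < N) A (f j) in
  let p := M ord0 ord_max in let q := M ord_max ord_max in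
  [/\ coprimez p q, 0 <= p, 1 <= q & p + q <= 2 ^+ N].
Proof.
elim: N f => [|N IHN] f /=; first by rewrite big_ord0 !mxE.
rewrite big_ord_recl.
have := IHN (fun j => f (lift ord0 j)); move: (\prod_(i < N) _) => M /=.
rewrite A_mul_col_top A_mul_col_bottom.
move: (M ord0 ord_max) (M ord_max ord_max) => p q [cpq p0 q1 pq].
rewrite exprS; case: (f ord0) => /=; rewrite !(mul1r, mul0r, add0r, addr0).
  by split; [rewrite coprimez_sym /coprimez gcdzDr -/(coprimez q p) coprimez_sym
    | lra | lra | lra].
by split; [rewrite /coprimez gcdzDl | lra | lra | lra].
Qed.

Section AbsLnBounds.
Context {R : realType}.
Implicit Types (x y a L : R).

Lemma normr_ln_le x L : 0 < x -> expR (- L) <= x <= expR L -> `|ln x| <= L.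
Proof.
move=> x0; rewrite -[X in _ <= X <= _](lnK (x := x)) ?posrE//.
by rewrite !ler_expR ler_norml.
Qed.

(** The reciprocal power has logarithm [- a * ln x], and a symmetric bound on [ln x] does not see
    the sign. *)
Lemma powR_bounds x a L : 0 < x -> 0 <= a -> `|ln x| <= L ->
  expR (- (a * L)) <= 1 / (x `^ a) <= expR (a * L).
Proof.
move=> x0 a0 xL; rewrite div1r -powRN /powR gt_eqF// !ler_expR.
have : `|a * ln x| <= a * L by rewrite normrM ger0_norm// ler_wpM2l.
by rewrite ler_norml => /andP[? ?]; apply/andP; split; lra.
Qed.

Lemma cvg_powR_natN (s : R) : 0 < s -> (N%:R `^ (- s)) @[N --> \oo] --> (0 : R).
Proof.
move=> s0; apply/cvgr0Pnorm_le => e e0.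
near=> N.
(* [powR] unfolds to [expR (a * ln x)] only at a nonzero base. *)
have N0 : 0 < N%:R :> R by rewrite ltr0n; near: N; exact: nbhs_infty_gt.
rewrite ger0_norm ?powR_ge0// /powR gt_eqF// -[leRHS](lnK (x := e)) ?posrE//.
rewrite ler_expR mulNr lerNl mulrC -ler_pdivrMr//.
(* The threshold is thus [N >= expR (- ln e / s)]. *)
rewrite -[leLHS]expRK ler_ln ?posrE ?expR_gt0//.
near: N; exact: nbhs_infty_ger.
Unshelve. all: by end_near. Qed.

Lemma linear_growth_div_powR_cvg0 (u : nat -> R) (K k : R) : 1 < k ->
  (forall N, `|u N| <= K * N.+1%:R) ->
  (u N / (N%:R `^ k)) @[N --> \oo] --> (0 : R).
Proof.
move=> k1 uK; apply/norm_cvg0P.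
(* The factor 2 comes from [N + 1 <= 2 * N] for [N >= 1]. *)
apply: (squeeze_cvgr (f := fun=> 0)
  (h := fun N => (2 * K) * N%:R `^ (- (k - 1)))).
- near=> N; rewrite normr_ge0 /=.
  have N1 : 1 <= N%:R :> R by rewrite ler1n; near: N; exact: nbhs_infty_gt.
  have N0 : N%:R != 0 :> R by rewrite gt_eqF// (lt_le_trans ltr01).
  (* At [N = 0] the growth bound reads [|u 0| <= K]. *)
  have K0 : 0 <= K by have := le_trans (normr_ge0 _) (uK 0); rewrite mulr1.
  rewrite normrM normfV (ger0_norm (powR_ge0 _ _)) -powRN.
  have -> : - (k - 1) = 1 + - k by ring.
  rewrite powRD ?N0 ?implybT// powRr1 ?ler0n// mulrA ler_wpM2r ?powR_ge0//.
  rewrite (le_trans (uK N))// -natr1 [2 * K]mulrC -mulrA ler_wpM2l//.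
  lra.
- exact: cvg_cst.
- rewrite -(mulr0 (2 * K)); apply: cvgM; first exact: cvg_cst.
  apply: cvg_powR_natN; lra.
Unshelve. all: by end_near. Qed.

Lemma word_gap_ln_bound (alpha C d : R) : 0 < alpha -> 0 < C -> 0 <= d ->
  (forall p q : int, coprimez p q -> 1 <= q ->
     C / (q%:~R `^ d) <= `|p%:~R - alpha * q%:~R|) ->
  exists2 K, 0 <= K & forall N (i : {ffun 'I_N -> bool}),
    let x := `|alpha * (wordq i)%:~R - (wordp i)%:~R| in
    0 < x /\ `|ln x| <= K * N.+1%:R.
Proof.
move=> alpha0 C0 d0 hdioph.
have l2 : 0 <= ln 2 :> R by apply: ln_ge0; lra.
have dl2 : 0 <= d * ln 2 by rewrite mulr_ge0.
have la : 0 <= ln (alpha + 1) by apply: ln_ge0; lra.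
(* The first two summands serve the lower bound on [ln x], the last two the upper bound; all are
   nonnegative, so their sum serves both, and [N.+1] absorbs constant and linear terms alike. *)
exists (`|ln C| + d * ln 2 + ln (alpha + 1) + ln 2).
  by rewrite !addr_ge0.
move=> N i /=; have [] := @prodA_right_column N i.
rewrite -/(mxword i) -/(wordp i) -/(wordq i).
move: (wordp i) (wordq i) => p q cpq p0 q1 pq.
have q1R : 1 <= q%:~R :> R by rewrite ler1z.
have p0R : 0 <= p%:~R :> R by rewrite ler0z.
have pqR : p%:~R + q%:~R <= 2 ^+ N :> R.
  by have := pq; rewrite -(ler_int R) rmorphD rmorphXn.
have lo := hdioph _ _ cpq q1; rewrite distrC in lo.
have Cq0 : 0 < C / (q%:~R `^ d) by rewrite divr_gt0// powR_gt0//; lra.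
have x0 := lt_le_trans Cq0 lo.
(* As [p] and [q] are nonnegative, each is at most [p + q], hence at most [2 ^+ N]. *)
have hi : `|alpha * q%:~R - p%:~R| <= (alpha + 1) * 2 ^+ N.
  rewrite ler_norml; apply/andP; split; nra.
split=> //.
have lnhi : ln `|alpha * q%:~R - p%:~R| <= ln (alpha + 1) + ln 2 * N%:R.
  have a1 : 0 < alpha + 1 by lra.
  have p2 : 0 < 2 ^+ N :> R by rewrite exprn_gt0.
  rewrite mulr_natr -lnXn// -lnM ?posrE// ler_ln ?posrE//.
  exact: mulr_gt0.
have lnq : ln (q%:~R) <= ln 2 * N%:R :> R.
  rewrite mulr_natr -lnXn// ler_ln ?posrE ?exprn_gt0//; lra.
(* Since [0 <= d], the upper bound on [ln q] turns into a lower bound on the logarithm of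
   [C / q^d]. *)
have lnlo : ln C - d * (ln 2 * N%:R) <= ln `|alpha * q%:~R - p%:~R|.
  have := lo; rewrite -ler_ln ?posrE// ln_div ?posrE ?powR_gt0//; last lra.
  rewrite ln_powR; apply: le_trans; rewrite lerB// ler_wpM2l//.
have N0 : 0 <= N%:R :> R by [].
have nlo : - `|ln C| <= ln C by rewrite lerNnormlW.
have nC := normr_ge0 (ln C).
rewrite -natr1 ler_norml; apply/andP; split; nra.
Qed.

Lemma ln_Z_linear_bound (alpha beta C d : R) :
  0 < alpha -> 0 <= beta -> 0 < C -> 0 <= d ->
  (forall p q : int, coprimez p q -> 1 <= q ->
     C / (q%:~R `^ d) <= `|p%:~R - alpha * q%:~R|) ->
  exists K, forall N, `|ln (Z N alpha beta)| <= K * N.+1%:R.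
Proof.
move=> alpha0 beta0 C0 d0 hdioph.
have [K K0 gapK] := @word_gap_ln_bound _ _ _ alpha0 C0 d0 hdioph.
(* [beta * K] controls each single term, [ln 2] the number [2 ^ N] of terms. *)
exists (beta * K + ln 2) => N.
have termP (i : {ffun 'I_N -> bool}) :
    expR (- (beta * (K * N.+1%:R)))
      <= 1 / (`|alpha * (wordq i)%:~R - (wordp i)%:~R| `^ beta)
      <= expR (beta * (K * N.+1%:R)).
  by have [x0 xK] := gapK N i; apply: powR_bounds.
have l2 : 0 <= ln 2 :> R by apply: ln_ge0; lra.
have N0 : 0 <= N%:R :> R by [].
have Zlo : expR (- (beta * (K * N.+1%:R))) <= Z N alpha beta.
  (* All terms are nonnegative, so one of them, here that of the constant word, already bounds the
     sum from below. *)
  rewrite /Z (bigD1 [ffun=> false])//= -[leLHS]addr0 lerD//.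
    by have /andP[] := termP [ffun=> false].
  by apply: sumr_ge0 => i _; rewrite divr_ge0// powR_ge0.
have Zhi : Z N alpha beta <= expR (ln 2 * N%:R + beta * (K * N.+1%:R)).
  rewrite expRD expRM_natr lnK ?posrE// mulrC -natrX.
  apply: le_trans (ler_sum _ (fun i _ => proj2 (andP (termP i)))) _.
  by rewrite sumr_const card_ffun card_bool card_ord -[leLHS]mulr_natr.
apply: normr_ln_le; first exact: lt_le_trans (expR_gt0 _) Zlo.
apply/andP; split.
- apply: le_trans Zlo; rewrite ler_expR -natr1; nra.
- apply: le_trans Zhi _; rewrite ler_expR -natr1; nra.
Qed.

End AbsLnBounds.

Theorem theorem4p4 (R : realType) (alpha : R) (halpha : 0 < alpha)
  (hdioph : exists C d : R, [/\ 0 < C, 2 <= d &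
     forall p q : int, coprimez p q -> 1 <= q ->
       C / (q%:~R `^ d) <= `|p%:~R - alpha * q%:~R| ]) :
  (forall k beta : R, 1 < k -> 2 < beta ->
     (ln (Z N alpha beta) / (N%:R `^ k)) @[N --> \oo] --> (0 : R)) /\
  (forall k : R, 1 < k ->
     free_energy_limit_above k alpha 2 /\ has_free_energy_limit k alpha).
Proof.
have cvg0 k beta : 1 < k -> 2 < beta ->
    (ln (Z N alpha beta) / (N%:R `^ k)) @[N --> \oo] --> (0 : R).
  move=> k1 beta2; have [C [d [C0 d2 CdP]]] := hdioph.
  have beta0 : 0 <= beta by lra.
  have d0 : 0 <= d by lra.
  have [K ZK] := @ln_Z_linear_bound _ _ _ _ _ halpha beta0 C0 d0 CdP.
  exact: linear_growth_div_powR_cvg0 k1 ZK.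
split=> // k k1.
have above : free_energy_limit_above k alpha 2.
  by move=> beta beta2; apply/cvg_ex; exists 0; exact: cvg0.
by split=> //; exists 2.
Qed.
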